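(* Let $X$ and $Y$ be topological spaces. If $X$ and $Y$ are strategically $k$-Menger, then $X\times Y$ is strategically $k$-Menger. In other words, the property of being strategically $k$-Menger is finitely productive.
   Context: No separation axioms are assumed on topological spaces. A $k$-cover of a space $Z$ is an open cover $\mathscr U$ of $Z$ such that every compact subset of $Z$ is contained in a member of $\mathscr U$; $\mathcal K_Z$ denotes the set of all $k$-covers of $Z$ (a $k$-cover is allowed to contain $Z$ itself). $[S]^{<\omega}$ denotes the set of finite subsets of $S$. The $k$-Menger game on $Z$ is the following two-player game of length $\omega$: in round $n\in\omega$, P1 plays $\mathscr U_n\in\mathcal K_Z$ and P2 responds with a finite set $\mathscr F_n\in[\mathscr U_n]^{<\omega}$. P2 wins if $\bigcup\{\mathscr F_n:n\in\omega\}\in\mathcal K_Z$; otherwise P1 wins. A strategy for P2 is a function $\sigma$ assigning to each non-empty finite sequence $\langle\mathscr U_0,\dots,\mathscr U_n\rangle$ of elements of $\mathcal K_Z$ an element of $[\mathscr U_n]^{<\omega}$; it is winning if $\bigcup\{\sigma(\mathscr U_0,\dots,\mathscr U_n):n\in\omega\}\in\mathcal K_Z$ for every sequence $\langle\mathscr U_n:n\in\omega\rangle$ of elements of $\mathcal K_Z$. The space $Z$ is strategically $k$-Menger if P2 has a winning strategy in this game. *)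

(* Defs.v *)
From mathcomp Require Import all_boot.
From mathcomp Require Import all_classical topology.

Set Implicit Arguments.
Unset Strict Implicit.
Unset Printing Implicit Defensive.

Local Open Scope classical_set_scope.

Definition open_cover (Z : topologicalType) (U : set (set Z)) : Prop :=
  U `<=` open /\ \bigcup_(A in U) A = setT.

Definition k_cover (Z : topologicalType) (U : set (set Z)) : Prop :=
  open_cover U /\ forall K : set Z, compact K -> exists2 A, U A & K `<=` A.

(* A strategy reads the nonempty history [:: U_0; ...; U_n] of P1's moves,
   written [rcons s U_n]. It is a total function on sequences, but only its
   values on nonempty sequences of k-covers are constrained or ever used. *)
Definition k_Menger_strategy (Z : topologicalType)
    (sigma : seq (set (set Z)) -> set (set Z)) : Prop :=
  forall (s : seq (set (set Z))) (U : set (set Z)),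
    (forall V, V \in rcons s U -> k_cover V) ->
    finite_set (sigma (rcons s U)) /\ sigma (rcons s U) `<=` U.

Definition k_Menger_winning (Z : topologicalType)
    (sigma : seq (set (set Z)) -> set (set Z)) : Prop :=
  forall U : nat -> set (set Z), (forall n, k_cover (U n)) ->
    k_cover (\bigcup_n sigma (mkseq U n.+1)).

Definition strategically_k_Menger (Z : topologicalType) : Prop :=
  exists sigma : seq (set (set Z)) -> set (set Z),
    k_Menger_strategy sigma /\ k_Menger_winning sigma.

(* Main.v *)
(** P2 plays on [X * Y] by keeping one history of P1's moves on [X] and a
    finite set [T] of histories of moves on [Y].  Given a k-cover [W] of
    [X * Y], the tube lemma and the finiteness of P2's answers on [Y] show that
    the open sets [U] of [X] for which some k-cover [VV] of [Y] has every
    [U * V], with [V] answering [VV] after a history of [T], inside a member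
    of [W], form a k-cover of [X].  P2's strategy on [X] picks finitely many
    such [U]; P2 answers [W] by the corresponding members of [W], and [T] grows
    by the histories of [T] extended by the [VV] of one of these [U].

    Histories stay in [T] forever, and P2's strategy on [X] may be assumed to
    catch every compact set infinitely often.  Hence, for compact [K], the
    rounds catching [K] yield a branch through the sets [T], that is, an
    infinite play on [Y], in which P2 catches any given compact [L]; at that
    round [K * L] is caught. *)

Require Import Defs.
From mathcomp Require Import all_boot.
From mathcomp Require Import all_classical topology.

Set Implicit Arguments.
Unset Strict Implicit.
Unset Printing Implicit Defensive.

Local Open Scope classical_set_scope.

(** * Tube lemma for compact sets, and repeated catching of compact sets *)

Lemma k_coverP (Z : topologicalType) (U : set (set Z)) :
  U `<=` open -> (forall K, compact K -> exists2 A, U A & K `<=` A) ->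
  k_cover U.
Proof.
move=> Uo Uk; split=> //; split=> //; rewrite -subTset => z _.
by have [A UA zA] := Uk _ (@compact_set1 _ z); exists A => //; exact: zA.
Qed.

(** Compactness in near-covering form: every sufficiently small member of [F] works near each point
    of [K], so one works for all of [K]. A general filter allows both [nbhs y] and [set_nbhs K] as
    [F]. *)
Lemma compact_tube_filter (X : topologicalType) (I : Type) (F : set_system I)
    (K : set X) (w : set (X * I)) :
  ProperFilter F -> compact K ->
  (forall x, K x -> exists A B, [/\ nbhs x A, F B & A `*` B `<=` w]) ->
  exists A B, [/\ set_nbhs K A, F B & A `*` B `<=` w].
Proof.
move=> FF /compact_near_coveringP cK Kw.
pose P (B : set I) (x : X) := nbhs x [set x' | [set x'] `*` B `<=` w].
have Pdown B1 B2 : B1 `<=` B2 -> K `<=` P B2 -> K `<=` P B1.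
  move=> B12 KB2 x /KB2; apply: filterS => x' B2w [x1 y] [/= -> /B12 B2y].
  exact: B2w.
have /(near_powerset_filter_fromP _ Pdown)[B FB KB] :
    \forall B \near powerset_filter_from F, K `<=` P B.
  apply: cK => x /Kw [A [B [xA FB ABw]]].
  exists (A°, [set B' | B' `<=` B]).
    split; first exact: nbhs_interior.
    exact: small_set_sub.
  move=> [x' B'] [/= Ax' B'B]; move: Ax'; apply: filterS => x1 Ax1 [x2 y].
  by move=> [/= -> /B'B By]; apply: ABw.
exists [set x | [set x] `*` B `<=` w], B; split=> //.
by move=> [x y] [/= xw By]; apply: xw.
Qed.

Lemma compact_tube (X Y : topologicalType) (K : set X) (L : set Y)
    (w : set (X * Y)) :
  open w -> compact K -> compact L -> K `*` L `<=` w ->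
  exists U V, [/\ set_nbhs K U, set_nbhs L V & U `*` V `<=` w].
Proof.
(* The filter [set_nbhs K] is proper only for nonempty [K]. *)
move=> wo cK cL KLw; have [->|/set0P K0] := eqVneq K set0.
  exists set0, setT; split; last by move=> [x y] [].
    by apply/set_nbhsP; exists set0; split=> //; exact: open0.
  by apply/set_nbhsP; exists setT; split=> //; exact: openT.
(* Swapping the factors lets compactness of [L] be applied with filter [set_nbhs K], after
   compactness of [K] has been applied at each point of [L]. *)
pose w' : set (Y * X) := [set p | w (p.2, p.1)].
suff [V [U [LV KU VUw]]] :
    exists V U, [/\ set_nbhs L V, set_nbhs K U & V `*` U `<=` w'].
  exists U, V; split=> // -[x y] [Ux Vy].
  exact: (VUw (y, x)).
apply: compact_tube_filter => // [|y Ly]; first exact: set_nbhs_pfilter.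
have [U [V [KU yV UVw]]] :
    exists U V, [/\ set_nbhs K U, nbhs y V & U `*` V `<=` w].
  apply: compact_tube_filter => // x Kx.
  have : nbhs (x, y) w by apply: open_nbhs_nbhs; split=> //; exact: KLw.
  by move=> [[A B] [/= xA yB] ABw]; exists A, B.
by exists V, U; split=> // -[y' x'] [Vy Ux]; exact: (UVw (x', y')).
Qed.

Lemma finite_near (I : choiceType) (T : Type) (D : set I) (f : I -> set T)
    (F : set_system T) :
  Filter F -> finite_set D -> (forall i, D i -> F (f i)) ->
  F (\bigcap_(i in D) f i).
Proof. by move=> FF /finite_fsetP[A ->] fF; exact: filter_bigI. Qed.

(* At each round, P2 also answers as if the game had started at any one of the
   previous rounds. *)
Lemma strategically_k_Menger_infinitely_often (Z : topologicalType) :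
  strategically_k_Menger Z ->
  exists sigma : seq (set (set Z)) -> set (set Z), k_Menger_strategy sigma /\
    forall U : nat -> set (set Z), (forall n, k_cover (U n)) ->
    forall (K : set Z) (N : nat), compact K ->
    exists n, (N <= n)%N /\ exists2 A, sigma (mkseq U n.+1) A & K `<=` A.
Proof.
move=> [sigma [sS sW]].
exists (fun s => \bigcup_(j in `I_(size s)) sigma (drop j s)); split.
  move=> s U kU.
  have {}sS j : (j < (size s).+1)%N ->
      finite_set (sigma (drop j (rcons s U))) /\
      sigma (drop j (rcons s U)) `<=` U.
    rewrite ltnS => js; rewrite drop_rcons //; apply: sS => V VsU.
    by apply: kU; apply: (@mem_drop j); rewrite drop_rcons.
  rewrite size_rcons; split.
    by apply: bigcup_finite; [exact: finite_II | move=> j /sS[]].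
  by move=> A [j /sS[_ jU] /jU].
move=> U kU K N cK.
(* The game restarted at round [N] catches [K] at its move [m]; this answer is the term [j = N] of
   the union in round [N + m]. *)
have [_ /(_ K cK)] := sW (fun i => U (N + i)%N) (fun i => kU _).
move=> [A [m _ mA] KA]; exists (N + m)%N; split; first exact: leq_addr.
exists A => //; exists N; first by rewrite /mkset size_mkseq ltnS leq_addr.
rewrite /mkseq -map_drop drop_iota add0n subSn ?leq_addr// addKn.
by rewrite -[X in iota X _](addn0 N) iotaDl -map_comp.
Qed.

(** * The strategy on the product *)

Section product_strategy.
Context (X Y : topologicalType).
Implicit Types (W : set (set (X * Y))) (T : set (seq (set (set Y)))).
Implicit Types (U : set X) (VV : set (set Y)).
Implicit Types (sigma : seq (set (set X)) -> set (set X)).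
Implicit Types (tau : seq (set (set Y)) -> set (set Y)).

Definition refining_cover tau T W U VV :=
  k_cover VV /\ forall t, T t -> forall V, tau (rcons t VV) V ->
    exists w, W w /\ U `*` V `<=` w.

Definition cover_fst tau T W : set (set X) :=
  [set U | open U /\ exists VV, refining_cover tau T W U VV].

Definition cover_snd tau T W U : set (set Y) :=
  xget set0 (refining_cover tau T W U).

Definition rectangle_hull W U (V : set Y) : set (X * Y) :=
  xget set0 [set w | W w /\ U `*` V `<=` w].

Definition histories T := finite_set T /\
  forall t, T t -> forall VV, VV \in t -> k_cover VV.

Definition product_answer tau (A : set (set X)) T W :=
  \bigcup_(U in A) \bigcup_(t in T)
    rectangle_hull W U @` tau (rcons t (cover_snd tau T W U)).

(** Old histories are kept so that a branch survives the rounds that do not extend it. *)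
Definition next_histories tau (A : set (set X)) T W :=
  T `|` [set rcons t (cover_snd tau T W U) | t in T & U in A].

(* The components are the history on [X], the histories on [Y], and the answer
   to the last move. *)
Definition product_state : Type :=
  seq (set (set X)) * set (seq (set (set Y))) * set (set (X * Y)).

Definition product_step sigma tau (p : product_state) W : product_state :=
  let s := rcons p.1.1 (cover_fst tau p.1.2 W) in
  (s, next_histories tau (sigma s) p.1.2 W,
   product_answer tau (sigma s) p.1.2 W).

Definition product_run sigma tau (s : seq (set (set (X * Y)))) :=
  foldl (product_step sigma tau) ([::], [set [::]], set0) s.

Lemma cover_sndP tau T W U : cover_fst tau T W U ->
  refining_cover tau T W U (cover_snd tau T W U).
Proof. by move=> [_ VV]; exact: xgetPex. Qed.

Lemma rectangle_hullP tau T W U t V : cover_fst tau T W U -> T t ->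
  tau (rcons t (cover_snd tau T W U)) V ->
  W (rectangle_hull W U V) /\ U `*` V `<=` rectangle_hull W U V.
Proof.
move=> /cover_sndP[_ h] Tt tV.
exact: (@xgetPex _ set0 [set w | W w /\ U `*` V `<=` w] (h _ Tt _ tV)).
Qed.

Lemma histories_rcons T VV t : histories T -> k_cover VV -> T t ->
  forall V, V \in rcons t VV -> k_cover V.
Proof.
move=> [_ hT] kVV Tt V; rewrite mem_rcons inE => /orP[/eqP->//|].
exact: hT.
Qed.

Lemma k_cover_fst tau T W : k_Menger_strategy tau -> histories T ->
  k_cover W -> k_cover (cover_fst tau T W).
Proof.
move=> tS hT [[Wo _] Wk]; apply: k_coverP => [U []//|K cK].
(* This cover depends on [K] but not yet on [U], so the answers of [tau] to it are known before [U]
   is chosen. *)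
pose VV := [set V : set Y | open V /\
  exists U, set_nbhs K U /\ exists w, W w /\ U `*` V `<=` w].
have kVV : k_cover VV.
  apply: k_coverP => [V []//|L cL].
  have [w Ww KLw] := Wk _ (compact_setX cK cL).
  have [U [V [KU /set_nbhsP[V' [V'o LV' V'V]] UVw]]] :=
    compact_tube (Wo _ Ww) cK cL KLw.
  exists V' => //; split=> //; exists U; split=> //; exists w; split=> //.
  by move=> [x y] [/= Ux /V'V Vy]; apply: UVw.
pose answers := \bigcup_(t in T) tau (rcons t VV).
have ans_fin : finite_set answers.
  apply: bigcup_finite; first by case: hT.
  by move=> t Tt; case: (tS _ _ (histories_rcons hT kVV Tt)).
have ansVV V : answers V -> VV V.
  by move=> [t Tt]; case: (tS _ _ (histories_rcons hT kVV Tt)) => _; apply.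
pose P V U := set_nbhs K U /\ exists w, W w /\ U `*` V `<=` w.
have PV V : answers V -> P V (xget set0 (P V)).
  by move=> /ansVV[_]; exact: xgetPex.
(* One neighbourhood of [K] is chosen per answer; there are finitely many answers, so the
   intersection is still a neighbourhood of [K]. *)
have /set_nbhsP[U [Uo KU UP]] :
    set_nbhs K (\bigcap_(V in answers) xget set0 (P V)).
  by apply: finite_near => // V /PV[].
exists U => //; split=> //; exists VV; split=> // t Tt V tV.
have ansV : answers V by exists t.
have [_ [w [Ww VPw]]] := PV V ansV; exists w; split=> // -[x y] [/= Ux Vy].
by apply: VPw; split=> //=; exact: UP.
Qed.

Lemma histories_next tau A T W : finite_set A ->
  A `<=` cover_fst tau T W -> histories T ->
  histories (next_histories tau A T W).
Proof.
move=> Af AU hT; split.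
  rewrite finite_setU; split; first exact: hT.1.
  by apply: finite_image2 => //; exact: hT.1.
move=> t [|[t' Tt' [U /AU/cover_sndP[kU _] <-]]]; first exact: hT.2.
exact: (histories_rcons hT kU Tt').
Qed.

Lemma product_answerP tau A T W : k_Menger_strategy tau -> finite_set A ->
  A `<=` cover_fst tau T W -> histories T ->
  finite_set (product_answer tau A T W) /\ product_answer tau A T W `<=` W.
Proof.
move=> tS Af AU hT; split.
  apply: bigcup_finite => // U /AU/cover_sndP[kU _].
  apply: bigcup_finite => [|t Tt]; first by case: hT.
  by apply: finite_image; case: (tS _ _ (histories_rcons hT kU Tt)).
move=> w [U /AU cU [t Tt [V tV <-]]].
by have [] := rectangle_hullP cU Tt tV.
Qed.

(** * Invariant of a run, legality and winning *)

Definition good_state (p : product_state) :=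
  (forall V, V \in p.1.1 -> k_cover V) /\ histories p.1.2.

Lemma product_stepP sigma tau p W :
  k_Menger_strategy sigma -> k_Menger_strategy tau ->
  good_state p -> k_cover W ->
  let A := sigma (rcons p.1.1 (cover_fst tau p.1.2 W)) in
  finite_set A /\ A `<=` cover_fst tau p.1.2 W.
Proof.
move=> sS tS [ps pT] kW; apply: sS => V; rewrite mem_rcons inE.
by move=> /orP[/eqP->|/ps//]; exact: k_cover_fst.
Qed.

Lemma good_product_step sigma tau p W :
  k_Menger_strategy sigma -> k_Menger_strategy tau ->
  good_state p -> k_cover W -> good_state (product_step sigma tau p W).
Proof.
move=> sS tS gp kW; have [Af AU] := product_stepP sS tS gp kW.
have [ps pT] := gp; split=> /=; last exact: histories_next.
move=> V; rewrite mem_rcons inE => /orP[/eqP->|/ps//].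
exact: k_cover_fst.
Qed.

Lemma good_product_run sigma tau s :
  k_Menger_strategy sigma -> k_Menger_strategy tau ->
  (forall W, W \in s -> k_cover W) -> good_state (product_run sigma tau s).
Proof.
move=> sS tS; elim/last_ind: s => [_|s W IHs kW].
  split=> //; split=> /= [|t ->//]; exact: finite_set1.
rewrite /product_run foldl_rcons; apply: good_product_step => //.
  by apply: IHs => V Vs; apply: kW; rewrite mem_rcons inE Vs orbT.
by apply: kW; rewrite mem_rcons mem_head.
Qed.

Lemma product_run_strategy sigma tau :
  k_Menger_strategy sigma -> k_Menger_strategy tau ->
  k_Menger_strategy (fun s => (product_run sigma tau s).2).
Proof.
move=> sS tS s W ksW.
have gp : good_state (product_run sigma tau s).
  apply: good_product_run => // V Vs; apply: ksW.
  by rewrite mem_rcons inE Vs orbT.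
have kW : k_cover W by apply: ksW; rewrite mem_rcons mem_head.
have [Af AU] := product_stepP sS tS gp kW.
rewrite /product_run foldl_rcons; apply: product_answerP => //.
by case: gp.
Qed.

Lemma product_run_winning sigma tau :
  k_Menger_strategy sigma -> k_Menger_strategy tau ->
  (forall U : nat -> set (set X), (forall n, k_cover (U n)) ->
    forall (K : set X) (N : nat), compact K ->
    exists n, (N <= n)%N /\ exists2 A, sigma (mkseq U n.+1) A & K `<=` A) ->
  k_Menger_winning tau ->
  k_Menger_winning (fun s => (product_run sigma tau s).2).
Proof.
move=> sS tS sW tW W kW.
pose run n := product_run sigma tau (mkseq W n).
have runS n : run n.+1 = product_step sigma tau (run n) (W n).
  by rewrite /run mkseqS /product_run foldl_rcons.
have run_good n : good_state (run n).
  by apply: good_product_run => // V /mapP[i _ ->].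
pose T n := (run n).1.2.
pose UU n := cover_fst tau (T n) (W n).
have run_fst n : (run n).1.1 = mkseq UU n.
  by elim: n => // n IHn; rewrite runS /= IHn -mkseqS.
have TS n : T n.+1 = next_histories tau (sigma (mkseq UU n.+1)) (T n) (W n).
  by rewrite /T runS /= run_fst -mkseqS.
have ansS n : (run n.+1).2 =
    product_answer tau (sigma (mkseq UU n.+1)) (T n) (W n).
  by rewrite runS /= run_fst -mkseqS.
have kUU n : k_cover (UU n) by apply: k_cover_fst => //; case: (run_good n).
have sUU n : sigma (mkseq UU n.+1) `<=` UU n.
  have [_] := product_stepP sS tS (run_good n) (kW n).
  by rewrite run_fst -mkseqS.
have Tmono m n : (m <= n)%N -> T m `<=` T n.
  move=> /subnK <-; elim: (n - m)%N => // k IHk t /IHk Tt.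
  by rewrite addSn TS; left.
apply: k_coverP => [w [n _]|C cC].
  rewrite -/(run n.+1) ansS.
  have [_ h] := product_answerP (W := W n) tS
    (product_stepP sS tS (run_good n) (kW n)).1
    (product_stepP sS tS (run_good n) (kW n)).2 (run_good n).2.
  move: h; rewrite run_fst -mkseqS => h /h.
  by case: (kW n) => -[+ _] _; apply.
(* Since [C] lies in the product of its projections, it suffices to catch [K] and [L] together. *)
pose K := fst @` C; pose L := snd @` C.
have cK : compact K.
  apply: continuous_compact => //; apply: continuous_subspaceT => x.
  exact: cvg_fst.
have cL : compact L.
  apply: continuous_compact => //; apply: continuous_subspaceT => x.
  exact: cvg_snd.
have /choice[r rP] N : exists r : nat * set X,
    [/\ (N <= r.1)%N, sigma (mkseq UU r.1.+1) r.2 & K `<=` r.2].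
  by have [n [Nn [U sU KU]]] := sW _ kUU K N cK; exists (n, U).
(* The search for the next catch of [K] starts one round after the previous one, so the catching
   rounds [m k] strictly increase. *)
pose idx k := iter k (fun m => (r m).1.+1) 0%N.
pose m k := (r (idx k)).1; pose U k := (r (idx k)).2.
have mS k : (m k < m k.+1)%N by have [] := rP (idx k.+1).
have sU k : sigma (mkseq UU (m k).+1) (U k) by have [] := rP (idx k).
pose VV k := cover_snd tau (T (m k)) (W (m k)) (U k).
have kVV k : k_cover (VV k) by have [] := cover_sndP (sUU _ _ (sU k)).
(* Round [m k] appends [VV k] to the branch, and monotonicity of [T] carries it to round
   [m k.+1]. *)
have TVV k : T (m k) (mkseq VV k).
  elim: k => [|k IHk]; first exact: (Tmono 0%N).
  apply: (Tmono _ _ (mS k)); rewrite TS (mkseqS VV); right.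
  by exists (mkseq VV k) => //; exists (U k).
(* Move [k] of the play on [Y] catching [L] takes place in round [m k], where [U k] contains [K]. *)
have [_ /(_ L cL)[V [k _]]] := tW _ kVV; rewrite mkseqS => tV LV.
have [_ UVw] := rectangle_hullP (sUU _ _ (sU k)) (TVV k) tV.
exists (rectangle_hull (W (m k)) (U k) V).
  exists (m k) => //; rewrite -/(run _) ansS.
  by exists (U k) => //; exists (mkseq VV k) => //; exists V.
move=> [x y] Cxy; apply: UVw; split=> /=; last by apply: LV; exists (x, y).
by have [_ _] := rP (idx k); apply; exists (x, y).
Qed.

End product_strategy.

Theorem theorem4p27 (X Y : topologicalType)
  (hX : strategically_k_Menger X) (hY : strategically_k_Menger Y) :
  strategically_k_Menger (X * Y)%type.
Proof.
have [sigma [sS sW]] := strategically_k_Menger_infinitely_often hX.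
have [tau [tS tW]] := hY.
exists (fun s => (product_run sigma tau s).2); split.
  exact: product_run_strategy.
exact: product_run_winning.
Qed.
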